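(* Suppose $Q\succ0$, $R\succ0$, $\lambda_y>0$ and $\Gamma,\mathcal{U},\mathcal{Y}$ are convex sets. Consider the bi-level problem $$\text{(B)}\qquad \min_{g,\ \sigma_y\in\Gamma,\ u\in\mathcal{U},\ y\in\mathcal{Y}}\ \|y\|_Q^2+\|u\|_R^2+\lambda_y\|\sigma_y\|_2^2\quad\text{subject to}\quad H^*g=\mathrm{col}(u_{\mathrm{ini}},\,y_{\mathrm{ini}}+\sigma_y,\,u,\,y),$$ where $H^*$ is the $\tilde H$-component of a solution of $$\min_{\tilde H,\,K}\ \|\tilde H-H_{\mathrm d}\|_F^2\quad\text{subject to}\quad \tilde Y_{\mathrm F}=K\,\mathrm{col}(U_{\mathrm P},Y_{\mathrm P},U_{\mathrm F}),$$ and the single-level problem $$\text{(L)}\qquad \min_{g,\ \sigma_y\in\Gamma,\ u\in\mathcal{U},\ y\in\mathcal{Y}}\ \|u\|_R^2+\|y\|_Q^2+\lambda_y\|\sigma_y\|_2^2+\lambda_g\|(I-\Pi_1)g\|_2\quad\text{subject to}\quad H_{\mathrm d}\,g=\mathrm{col}(u_{\mathrm{ini}},\,y_{\mathrm{ini}}+\sigma_y,\,u,\,y).$$ Then for any $\lambda_g\ge0$, (L) is a convex relaxation of (B), that is: 1) problem (L) is convex; 2) any feasible $(\sigma_y,u,y)$ for (B) is feasible for (L); 3) the optimal value of (L) is smaller than or equal to that of (B).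
   Context: Setting. $m,p,T_{\mathrm{ini}},N,T$ are positive integers, $L:=T_{\mathrm{ini}}+N<T$. $\mathrm{col}(\cdot)$ stacks vectors/matrices vertically. For a sequence $\omega=\mathrm{col}(\omega(1),\dots,\omega(T))$, $\mathcal{H}_L(\omega)$ is the block Hankel matrix with $L$ block rows and $T-L+1$ columns whose $j$-th column is $\mathrm{col}(\omega(j),\dots,\omega(j+L-1))$. Given data $u_{\mathrm d}\in\mathbb{R}^{mT}$, $y_{\mathrm d}\in\mathbb{R}^{pT}$ (arbitrary, possibly from a noisy or nonlinear system), partition $\mathcal{H}_L(u_{\mathrm d})=\mathrm{col}(U_{\mathrm P},U_{\mathrm F})$ and $\mathcal{H}_L(y_{\mathrm d})=\mathrm{col}(Y_{\mathrm P},Y_{\mathrm F})$, where $U_{\mathrm P},Y_{\mathrm P}$ consist of the first $T_{\mathrm{ini}}$ block rows and $U_{\mathrm F},Y_{\mathrm F}$ of the last $N$ block rows. Put $H_{\mathrm d}:=\mathrm{col}(U_{\mathrm P},Y_{\mathrm P},U_{\mathrm F},Y_{\mathrm F})$. Put $H_1:=\mathrm{col}(U_{\mathrm P},Y_{\mathrm P},U_{\mathrm F})$ and $\Pi_1:=H_1^\dagger H_1$ ($\dagger$ = Moore–Penrose inverse). In the inner problem of (B), $\tilde H$ has the same size and block partition as $H_{\mathrm d}$, $\tilde Y_{\mathrm F}$ is its last block (the one corresponding to $Y_{\mathrm F}$), $K$ is a free coefficient matrix, and $U_{\mathrm P},Y_{\mathrm P},U_{\mathrm F}$ are the given data. Vectors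 $u_{\mathrm{ini}}\in\mathbb{R}^{mT_{\mathrm{ini}}}$, $y_{\mathrm{ini}}\in\mathbb{R}^{pT_{\mathrm{ini}}}$ are given. Decision variables: $g\in\mathbb{R}^{T-L+1}$, $\sigma_y\in\mathbb{R}^{pT_{\mathrm{ini}}}$, $u\in\mathbb{R}^{mN}$, $y\in\mathbb{R}^{pN}$. $\|y\|_Q^2$ denotes $\sum_k y(k)^{\mathsf T}Qy(k)$ over the $N$ blocks $y(k)\in\mathbb{R}^p$ of $y$, similarly $\|u\|_R^2$. $\Gamma\subseteq\mathbb{R}^{pT_{\mathrm{ini}}}$, $\mathcal{U}\subseteq\mathbb{R}^m$, $\mathcal{Y}\subseteq\mathbb{R}^p$; by abuse of notation $u\in\mathcal{U}$ ($y\in\mathcal{Y}$) means that every block $u(k)\in\mathcal{U}$ ($y(k)\in\mathcal{Y}$). A triple $(\sigma_y,u,y)$ is called feasible for a problem if there is a $g$ such that $(g,\sigma_y,u,y)$ is feasible. *)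

(* Defs.v *)
From HB Require Import structures.
From mathcomp Require Import all_boot all_order all_algebra.
From mathcomp Require Import boolp classical_sets reals ereal.
From mathcomp Require Import topology convex.

Set Implicit Arguments.
Unset Strict Implicit.
Unset Printing Implicit Defensive.

Import Order.TTheory GRing.Theory Num.Theory.

Local Open Scope classical_set_scope.
Local Open Scope ring_scope.

(* The matrix norm supplied by the topology library is the max norm, hence this
   definition.  On column vectors it is the Euclidean norm. *)
Definition frobnorm (R : realType) (a b : nat) (A : 'M[R]_(a, b)) : R :=
  Num.sqrt (\sum_i \sum_j A i j ^+ 2).

Definition l2norm (R : realType) (n : nat) (v : 'cV[R]_n) : R := frobnorm v.

Definition posdef (R : realType) (n : nat) (Q : 'M[R]_n) : Prop :=
  Q^T = Q /\ forall x : 'cV[R]_n, x != 0 -> 0 < (x^T *m Q *m x) 0 0.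

(* The Penrose equations. *)
Definition is_mp_inverse (R : realType) (a b : nat)
    (A : 'M[R]_(a, b)) (X : 'M[R]_(b, a)) : Prop :=
  [/\ A *m X *m A = A, X *m A *m X = X,
      (A *m X)^T = A *m X & (X *m A)^T = X *m A].

Definition mp_inverse (R : realType) (a b : nat) (A : 'M[R]_(a, b)) :
  'M[R]_(b, a) := xget 0 [set X | is_mp_inverse A X].

Lemma gram_unitmx (R : realType) (a b : nat) (B : 'M[R]_(a, b)) :
  row_free B -> B *m B^T \in unitmx.
Proof.
move=> fB; rewrite -row_free_unit -kermx_eq0; apply/eqP/row_matrixP => i.
set x := row i _.
have xG : x *m (B *m B^T) = 0.
  by rewrite /x -row_mul mulmx_ker row0.
have sq0 : \sum_j (x *m B) 0 j ^+ 2 = 0.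
  have /matrixP /(_ 0 0) : (x *m B) *m (x *m B)^T = 0.
    by rewrite trmx_mul mulmxA -(mulmxA x) xG mul0mx.
  rewrite !mxE => E; rewrite -[RHS]E; apply: eq_bigr => j _.
  by rewrite [(_)^T _ _]mxE expr2.
have xB : x *m B = 0.
  apply/rowP => j; rewrite [RHS]mxE; apply/eqP; rewrite -sqrf_eq0.
  move/eqP: sq0; rewrite psumr_eq0 => [/allP /(_ j)|k _]; last exact: sqr_ge0.
  by rewrite mem_index_enum => /(_ isT).
by apply: (row_free_inj fB); rewrite row0 mul0mx.
Qed.

Lemma mp_inverse_full_rank (R : realType) (a r b : nat)
    (C : 'M[R]_(a, r)) (B : 'M[R]_(r, b)) :
  row_free C^T -> row_free B ->
  is_mp_inverse (C *m B)
    (B^T *m invmx (B *m B^T) *m (invmx (C^T *m C) *m C^T)).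
Proof.
move=> /gram_unitmx; rewrite trmxK => uC /gram_unitmx uB.
set X := B^T *m _ *m _.
have AX : C *m B *m X = C *m invmx (C^T *m C) *m C^T.
  by rewrite /X -!mulmxA (mulmxA B) (mulmxA (B *m B^T)) mulmxV // mul1mx.
have XA : X *m (C *m B) = B^T *m invmx (B *m B^T) *m B.
  by rewrite /X -!mulmxA (mulmxA C^T) (mulmxA (invmx (C^T *m C))) mulVmx //
    mul1mx.
split.
- by rewrite AX -!mulmxA (mulmxA C^T) (mulmxA (invmx (C^T *m C))) mulVmx //
    mul1mx.
- by rewrite XA /X -!mulmxA (mulmxA B) (mulmxA (B *m B^T)) mulmxV // mul1mx.
- by rewrite AX !trmx_mul trmx_inv !trmx_mul trmxK mulmxA.
- by rewrite XA !trmx_mul trmx_inv !trmx_mul trmxK mulmxA.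
Qed.

Lemma mp_inverse_exists (R : realType) (a b : nat) (A : 'M[R]_(a, b)) :
  exists X, is_mp_inverse A X.
Proof.
rewrite -(mulmx_base A); eexists; apply: mp_inverse_full_rank.
  by rewrite /row_free mxrank_tr; exact: col_base_full.
exact: row_base_free.
Qed.

Lemma mp_inverseP (R : realType) (a b : nat) (A : 'M[R]_(a, b)) :
  is_mp_inverse A (mp_inverse A).
Proof.
by rewrite /mp_inverse; case: xgetP => // none;
  have [X /none] := mp_inverse_exists A.
Qed.

Lemma mp_inverse_unique (R : realType) (a b : nat) (A : 'M[R]_(a, b))
    (X Y : 'M[R]_(b, a)) :
  is_mp_inverse A X -> is_mp_inverse A Y -> X = Y.
Proof.
move=> [AXA XAX sAX sXA] [AYA YAY sAY sYA].
have AXY : A *m X = A *m Y.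
  by rewrite -sAX -{1}AYA -mulmxA trmx_mul sAX sAY mulmxA AXA.
have XAY : X *m A = Y *m A.
  by rewrite -sXA -{1}AYA -mulmxA mulmxA trmx_mul sYA sXA -mulmxA
    [A *m (X *m A)]mulmxA AXA.
by rewrite -XAX XAY -mulmxA AXY mulmxA YAY.
Qed.

(* A vector col(w(1), ..., w(n)) with blocks w(k) in R^q has type 'cV_(n * q),
   coordinate i of block k sitting at position k * q + i = mxvec_index k i. *)
Definition stack (R : realType) (n q : nat) (w : 'I_n -> 'cV[R]_q) :
  'cV[R]_(n * q) := (mxvec (\matrix_(k < n) (w k)^T))^T.

Definition block (R : realType) (n q : nat) (v : 'cV[R]_(n * q)) (k : 'I_n) :
  'cV[R]_q := (row k (vec_mx v^T))^T.

Lemma stackK (R : realType) (n q : nat) (w : 'I_n -> 'cV[R]_q) (k : 'I_n) :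
  block (stack w) k = w k.
Proof. by rewrite /block /stack trmxK mxvecK rowK trmxK. Qed.

(* Totalised access; the default 0 is never reached by hankel when L <= T. *)
Definition block_nat (R : realType) (n q : nat) (v : 'cV[R]_(n * q)) (t : nat) :
  'cV[R]_q := oapp (block v) 0 (insub t).

Definition hankel (R : realType) (q T L : nat) (w : 'cV[R]_(T * q)) :
  'M[R]_(L * q, T - L + 1) :=
  \matrix_(i, j) stack (fun k : 'I_L => block_nat w (j + k)) i 0.

Lemma hankelE (R : realType) (q T L : nat) (w : 'cV[R]_(T * q))
    (j : 'I_(T - L + 1)) (k : 'I_L) (t : 'I_T) :
  t = (j + k)%N :> nat -> block (col j (hankel L w)) k = block w t.
Proof.
move=> tE; rewrite -[RHS](_ : block_nat w (j + k) = _); last first.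
  by rewrite /block_nat -tE valK.
rewrite -(stackK (fun k : 'I_L => block_nat w (j + k))); congr block.
by apply/colP => i; rewrite !mxE.
Qed.

Definition past (R : realType) (q a b c : nat) (H : 'M[R]_((a + b) * q, c)) :
  'M[R]_(a * q, c) := usubmx (castmx (mulnDl a b q, erefl c) H).

Definition future (R : realType) (q a b c : nat) (H : 'M[R]_((a + b) * q, c)) :
  'M[R]_(b * q, c) := dsubmx (castmx (mulnDl a b q, erefl c) H).

Section DataMatrices.
Context (R : realType) (m p Tini N T : nat).
Context (ud : 'cV[R]_(T * m)) (yd : 'cV[R]_(T * p)).
Local Notation L := (Tini + N)%N.

Definition data_UP : 'M_(Tini * m, T - L + 1) := past (hankel L ud).
Definition data_UF : 'M_(N * m, T - L + 1) := future (hankel L ud).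
Definition data_YP : 'M_(Tini * p, T - L + 1) := past (hankel L yd).
Definition data_YF : 'M_(N * p, T - L + 1) := future (hankel L yd).

Definition data_H1 : 'M_(Tini * m + (Tini * p + N * m), T - L + 1) :=
  col_mx data_UP (col_mx data_YP data_UF).

Definition data_Hd :
  'M_((Tini * m + (Tini * p + N * m)) + N * p, T - L + 1) :=
  col_mx data_H1 data_YF.

Definition data_Pi1 : 'M_(T - L + 1) := mp_inverse data_H1 *m data_H1.

End DataMatrices.

Record problem (R : realType) (V : Type) :=
  Problem { cost : V -> R; feasible : set V }.

Definition minimizer (R : realType) (V : Type) (P : problem R V) (x : V) : Prop :=
  feasible P x /\ forall z, feasible P z -> cost P x <= cost P z.

(* +oo when P is infeasible. *)
Definition optimal_value (R : realType) (V : Type) (P : problem R V) : \bar R :=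
  ereal_inf [set (cost P x)%:E | x in feasible P].

Definition convex_problem (R : realType) (V : lmodType R) (P : problem R V) :
    Prop :=
  @convex_set R V (feasible P) /\ @convex_function R V setT (cost P).

Definition wsqnorm (R : realType) (n q : nat) (Q : 'M[R]_q)
    (v : 'cV[R]_(n * q)) : R :=
  \sum_(k < n) ((block v k)^T *m Q *m block v k) 0 0.

(* Decision variables (g, sigma_y, u, y). *)
Notation decision R m p Tini N T :=
  ('cV[R]_(T - (Tini + N) + 1) * 'cV[R]_(Tini * p) *
   'cV[R]_(N * m) * 'cV[R]_(N * p))%type (only parsing).

Definition feasible_triple (R : realType) (m p Tini N T : nat)
    (P : problem R (decision R m p Tini N T)) (s : 'cV[R]_(Tini * p))
    (u : 'cV[R]_(N * m)) (y : 'cV[R]_(N * p)) : Prop :=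
  exists g, feasible P (g, s, u, y).

Section Problems.
Context (R : realType) (m p Tini N T : nat).
Context (ud : 'cV[R]_(T * m)) (yd : 'cV[R]_(T * p)).
Context (uini : 'cV[R]_(Tini * m)) (yini : 'cV[R]_(Tini * p)).
Context (Gamma : set 'cV[R]_(Tini * p)) (U : set 'cV[R]_m) (Y : set 'cV[R]_p).
Context (Q : 'M[R]_p) (Rw : 'M[R]_m) (lambda_y : R).
Local Notation L := (Tini + N)%N.
Local Notation decisions := (decision R m p Tini N T).

(* Variables (Htilde, K). *)
Definition inner_problem : problem R
    ('M[R]_((Tini * m + (Tini * p + N * m)) + N * p, T - L + 1) *
     'M[R]_(N * p, Tini * m + (Tini * p + N * m))) :=
  Problem (fun z => frobnorm (z.1 - data_Hd Tini N ud yd) ^+ 2)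
          [set z | dsubmx z.1 = z.2 *m data_H1 Tini N ud yd].

Definition trajectory_constraints
    (H : 'M[R]_((Tini * m + (Tini * p + N * m)) + N * p, T - L + 1)) :
    set decisions :=
  [set z | let: (g, s, u, y) := z in
    [/\ Gamma s, forall k, U (block u k), forall k, Y (block y k) &
        H *m g = col_mx (col_mx uini (col_mx (yini + s) u)) y]].

Definition bilevel_problem : problem R decisions :=
  Problem
    (fun z => let: (g, s, u, y) := z in
      wsqnorm Q y + wsqnorm Rw u + lambda_y * l2norm s ^+ 2)
    [set z | exists Hstar K,
      minimizer inner_problem (Hstar, K) /\ trajectory_constraints Hstar z].

Definition single_level_problem (lambda_g : R) : problem R decisions :=
  Problem
    (fun z => let: (g, s, u, y) := z in
      wsqnorm Rw u + wsqnorm Q y + lambda_y * l2norm s ^+ 2 +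
      lambda_g * l2norm ((1%:M - data_Pi1 Tini N ud yd) *m g))
    (trajectory_constraints (data_Hd Tini N ud yd)).

End Problems.

(* Main.v *)
Require Import Defs.
From HB Require Import structures.
From mathcomp Require Import all_boot all_order all_algebra.
From mathcomp Require Import boolp classical_sets reals ereal.
From mathcomp Require Import topology convex.
From mathcomp Require Import ring lra interval_inference.

Set Implicit Arguments.
Unset Strict Implicit.
Unset Printing Implicit Defensive.

Import Order.TTheory GRing.Theory Num.Theory.

Local Open Scope classical_set_scope.
Local Open Scope ring_scope.

(** Why a relaxation.  Let [Pi] be the orthogonal projection onto the row space
    of [H1].  In the inner problem the blocks of [Htilde] other than the last
    are free, so a minimizer copies the data [H1] there; its last block ranges
    over the multiples [K *m H1], and the nearest of them to [YF] is
    [YF *m Pi] ([least_squares_pythagoras]).  Hence the minimizing [Htilde] is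
    unique, equal to [col_mx H1 (YF *m Pi)] ([inner_minimizerE]), even though
    [K] need not be.

    If [g] satisfies the constraints for this matrix, then [Pi *m g] satisfies
    those for the raw data with the same [(sigma_y, u, y)], because
    [H1 *m Pi = H1] ([trajectory_constraints_project]).  Moreover [Pi] is
    idempotent, so the regularizer [(1 - Pi) g] vanishes at the new point
    ([regularizer_project]): the cost is the same whatever [lambda_g] is.
    This gives both the inclusion of the feasible triples and the inequality
    of the optimal values.

    Convexity of the single-level problem rests on the triangle inequality for
    the Euclidean norm, obtained from Cauchy-Schwarz, and on the convexity of
    the quadratic forms; the feasible set is cut out of a product of convex
    sets by an affine equation. *)

(** * The Frobenius inner product *)

Section Frobenius.
Context (R : realType).

Lemma frobnorm_ge0 a b (A : 'M[R]_(a, b)) : 0 <= frobnorm A.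
Proof. exact: sqrtr_ge0. Qed.

Lemma sqr_frobnorm_sum a b (A : 'M[R]_(a, b)) :
  frobnorm A ^+ 2 = \sum_i \sum_j A i j ^+ 2.
Proof.
by rewrite sqr_sqrtr //; do 2!apply: sumr_ge0 => ? _; exact: sqr_ge0.
Qed.

Lemma sqr_frobnorm a b (A : 'M[R]_(a, b)) :
  frobnorm A ^+ 2 = \tr (A *m A^T).
Proof.
rewrite sqr_frobnorm_sum; apply: eq_bigr => i _; rewrite mxE.
by apply: eq_bigr => j _; rewrite mxE expr2.
Qed.

Lemma frobnorm0 a b : frobnorm (0 : 'M[R]_(a, b)) = 0.
Proof. by apply/eqP; rewrite -sqrf_eq0 sqr_frobnorm mul0mx mxtrace0. Qed.

Lemma frobnorm_eq0 a b (A : 'M[R]_(a, b)) : frobnorm A = 0 -> A = 0.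
Proof.
move=> A0; have /eqP := sqr_frobnorm_sum A.
rewrite A0 expr0n /= eq_sym psumr_eq0 => [/allP H|i _]; last first.
  by apply: sumr_ge0 => ? _; exact: sqr_ge0.
apply/matrixP => i j; rewrite mxE; apply/eqP; rewrite -sqrf_eq0.
have := H i; rewrite mem_index_enum => /(_ isT) /=.
rewrite psumr_eq0 => [/allP /(_ j)|? _]; last exact: sqr_ge0.
by rewrite mem_index_enum => /(_ isT).
Qed.

(** The polarization identity for the inner product [\tr (A *m B^T)]; it serves
    both the triangle inequality and Pythagoras. *)
Lemma sqr_frobnormD a b (A B : 'M[R]_(a, b)) :
  frobnorm (A + B) ^+ 2 =
  frobnorm A ^+ 2 + frobnorm B ^+ 2 + \tr (A *m B^T) *+ 2.
Proof.
rewrite !sqr_frobnorm linearD /= mulmxDl !mulmxDr !mxtraceD.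
have -> : \tr (B *m A^T) = \tr (A *m B^T).
  by rewrite -mxtrace_tr trmx_mul trmxK.
ring.
Qed.

Lemma sqr_frobnorm_col_mx a1 a2 b (A : 'M[R]_(a1, b)) (B : 'M[R]_(a2, b)) :
  frobnorm (col_mx A B) ^+ 2 = frobnorm A ^+ 2 + frobnorm B ^+ 2.
Proof.
rewrite !sqr_frobnorm_sum big_split_ord /=.
by congr (_ + _); apply: eq_bigr => i _; apply: eq_bigr => j _;
  rewrite ?col_mxEu ?col_mxEd.
Qed.

Lemma frobnormZ a b (t : R) (A : 'M[R]_(a, b)) :
  0 <= t -> frobnorm (t *: A) = t * frobnorm A.
Proof.
move=> t0; apply/eqP.
rewrite -(eqrXn2 (n := 2)) ?mulr_ge0 ?frobnorm_ge0 //; apply/eqP.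
rewrite exprMn !sqr_frobnorm linearZ /= -scalemxAl -scalemxAr scalerA mxtraceZ.
by rewrite expr2.
Qed.

(** Expanding the squared norm of [|B| A - |A| B] gives the inequality
    multiplied by [2 |A| |B|], so a vanishing norm is treated apart. *)
Lemma Cauchy_Schwarz_frobnorm a b (A B : 'M[R]_(a, b)) :
  \tr (A *m B^T) <= frobnorm A * frobnorm B.
Proof.
have [/frobnorm_eq0 ->|nA] := eqVneq (frobnorm A) 0.
  by rewrite mul0mx mxtrace0 mulr_ge0 ?frobnorm_ge0.
have [/frobnorm_eq0 ->|nB] := eqVneq (frobnorm B) 0.
  by rewrite trmx0 mulmx0 mxtrace0 mulr_ge0 ?frobnorm_ge0.
have AB0 : 0 < frobnorm A * frobnorm B.
  by rewrite mulr_gt0 // lt_def ?nA ?nB frobnorm_ge0.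
have := sqr_ge0 (frobnorm (frobnorm B *: A + frobnorm A *: (- B))).
rewrite sqr_frobnormD.
have -> : \tr (frobnorm B *: A *m (frobnorm A *: - B)^T) =
    - (frobnorm A * frobnorm B * \tr (A *m B^T)).
  rewrite scalerN -scaleNr linearZ /= -scalemxAl -scalemxAr scalerA mxtraceZ.
  ring.
have -> : frobnorm (frobnorm A *: - B) = frobnorm A * frobnorm B.
  rewrite frobnormZ ?frobnorm_ge0 //; congr (_ * _).
  by congr Num.sqrt; do 2!apply: eq_bigr => ? _; rewrite mxE sqrrN.
rewrite frobnormZ ?frobnorm_ge0 // => H; rewrite -(ler_pM2l AB0).
nra.
Qed.

Lemma frobnorm_convex a b (A B : 'M[R]_(a, b)) (t : R) : 0 <= t <= 1 ->
  frobnorm (t *: A + (1 - t) *: B) <= t * frobnorm A + (1 - t) * frobnorm B.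
Proof.
move=> /andP[t0 t1]; have s0 : 0 <= 1 - t by rewrite subr_ge0.
rewrite -(ler_pXn2r (n := 2)) ?nnegrE ?addr_ge0 ?mulr_ge0 ?frobnorm_ge0 //.
rewrite sqr_frobnormD !frobnormZ // linearZ /= -scalemxAl -scalemxAr scalerA.
rewrite mxtraceZ -subr_ge0.
set dAB := \tr _; set nA := frobnorm A; set nB := frobnorm B.
have -> : (t * nA + (1 - t) * nB) ^+ 2 - ((t * nA) ^+ 2 +
    ((1 - t) * nB) ^+ 2 + t * (1 - t) * dAB *+ 2) =
    t * (1 - t) * (nA * nB - dAB) *+ 2 by ring.
by rewrite mulrn_wge0 // !mulr_ge0 // subr_ge0 Cauchy_Schwarz_frobnorm.
Qed.

(** The square is convex and increasing on nonnegative numbers, so it preserves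
    the convexity of the norm. *)
Lemma sqr_frobnorm_convex a b (A B : 'M[R]_(a, b)) (t : R) : 0 <= t <= 1 ->
  frobnorm (t *: A + (1 - t) *: B) ^+ 2 <=
  t * frobnorm A ^+ 2 + (1 - t) * frobnorm B ^+ 2.
Proof.
move=> t01; have := frobnorm_convex A B t01; case/andP: t01 => t0 t1.
have s0 : 0 <= 1 - t by rewrite subr_ge0.
move=> H; apply: (@le_trans _ _ ((t * frobnorm A + (1 - t) * frobnorm B) ^+ 2)).
  by rewrite ler_pXn2r ?nnegrE ?addr_ge0 ?mulr_ge0 ?frobnorm_ge0.
rewrite -subr_ge0.
have -> : t * frobnorm A ^+ 2 + (1 - t) * frobnorm B ^+ 2 -
    (t * frobnorm A + (1 - t) * frobnorm B) ^+ 2 =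
    t * (1 - t) * (frobnorm A - frobnorm B) ^+ 2 by ring.
by rewrite mulr_ge0 ?sqr_ge0 // mulr_ge0.
Qed.

End Frobenius.

(** * Quadratic forms and convex sets *)

Section Quadratic.
Context (R : realType).

(** Along a segment a quadratic form [q] lies below its chord by exactly
    [t (1 - t) q (x - y)]. *)
Lemma quadratic_form_convex q (Q : 'M[R]_q) (x y : 'cV[R]_q) (t : R) :
  posdef Q -> 0 <= t <= 1 ->
  ((t *: x + (1 - t) *: y)^T *m Q *m (t *: x + (1 - t) *: y)) 0 0 <=
  t * (x^T *m Q *m x) 0 0 + (1 - t) * (y^T *m Q *m y) 0 0.
Proof.
move=> [_ Qpos] /andP[t0 t1].
have Qxy0 : 0 <= ((x - y)^T *m Q *m (x - y)) 0 0.
  have [->|/Qpos/ltW//] := eqVneq (x - y) 0.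
  by rewrite mulmx0 mxE.
rewrite -subr_ge0; suff -> :
  t * (x^T *m Q *m x) 0 0 + (1 - t) * (y^T *m Q *m y) 0 0 -
  ((t *: x + (1 - t) *: y)^T *m Q *m (t *: x + (1 - t) *: y)) 0 0 =
  t * (1 - t) * ((x - y)^T *m Q *m (x - y)) 0 0.
  by rewrite !mulr_ge0 ?subr_ge0.
rewrite !(linearD, linearN, linearZ) /= !(mulmxDl, mulmxBl, mulNmx).
rewrite !(mulmxDr, mulmxBr, mulmxN, mulNmx, =^~ scalemxAl, =^~ scalemxAr).
set a := x^T *m _ *m x; set b := x^T *m _ *m y; set c := y^T *m _ *m x.
set d := y^T *m _ *m y.
clearbody a b c d; rewrite !mxE; ring.
Qed.

Lemma block_linear n q (v w : 'cV[R]_(n * q)) (k : 'I_n) (t s : R) :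
  block (t *: v + s *: w) k = t *: block v k + s *: block w k.
Proof. by rewrite /block !(linearD, linearZ). Qed.

Lemma wsqnorm_convex n q (Q : 'M[R]_q) (v w : 'cV[R]_(n * q)) (t : R) :
  posdef Q -> 0 <= t <= 1 ->
  wsqnorm Q (t *: v + (1 - t) *: w) <=
  t * wsqnorm Q v + (1 - t) * wsqnorm Q w.
Proof.
move=> Qpos t01; rewrite /wsqnorm !mulr_sumr -big_split /=.
by apply: ler_sum => k _; rewrite block_linear quadratic_form_convex.
Qed.

Lemma convex_set_comb (V : lmodType R) (A : set V) (x y : V) (t : {i01 R}) :
  @convex_set R V A -> A x -> A y -> A (t%:num *: x + (1 - t%:num) *: y).
Proof. by move=> cA Ax Ay; apply: set_mem; apply: cA; apply: mem_set. Qed.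

End Quadratic.

(** * Least squares in the coefficient matrix *)

Section LeastSquares.
Context (R : realType).

Lemma mulmx_mp_inverseK a b (A : 'M[R]_(a, b)) : A *m (mp_inverse A *m A) = A.
Proof. by rewrite mulmxA; case: (mp_inverseP A). Qed.

(** The residual [Y (Pi - 1)], with [Pi] the orthogonal projection onto the
    row space of [A], is orthogonal to every multiple of [A]; this is
    Pythagoras for the splitting of [K A - Y] along that projection. *)
Lemma least_squares_pythagoras a b c (A : 'M[R]_(a, b)) (Y : 'M[R]_(c, b))
    (K : 'M[R]_(c, a)) :
  let Pi := mp_inverse A *m A in
  frobnorm (K *m A - Y) ^+ 2 =
  frobnorm (K *m A - Y *m Pi) ^+ 2 + frobnorm (Y *m Pi - Y) ^+ 2.
Proof.
move=> Pi; have [_ _ _ sPi] := mp_inverseP A.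
rewrite -[K *m A - Y](subrKA (Y *m Pi)) sqr_frobnormD.
suff -> : (K *m A - Y *m Pi) *m (Y *m Pi - Y)^T = 0.
  by rewrite mxtrace0 mul0rn addr0.
have APi0 : A *m (Pi - 1%:M) = 0.
  by rewrite mulmxBr mulmx1 mulmx_mp_inverseK subrr.
have -> : Y *m Pi - Y = Y *m (Pi - 1%:M) by rewrite mulmxBr mulmx1.
rewrite trmx_mul linearB /= sPi trmx1.
rewrite (_ : K *m A - Y *m Pi = (K - Y *m mp_inverse A) *m A); last first.
  by rewrite mulmxBl mulmxA.
by rewrite -!mulmxA (mulmxA A) APi0 mul0mx mulmx0.
Qed.

End LeastSquares.

(** * The two problems *)

Section Relaxation.
Context (R : realType) (m p Tini N T : nat).
Context (ud : 'cV[R]_(T * m)) (yd : 'cV[R]_(T * p)).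
Context (uini : 'cV[R]_(Tini * m)) (yini : 'cV[R]_(Tini * p)).
Context (Gamma : set 'cV[R]_(Tini * p)) (U : set 'cV[R]_m) (Y : set 'cV[R]_p).
Context (Q : 'M[R]_p) (Rw : 'M[R]_m) (lambda_y : R).
Local Notation H1 := (data_H1 Tini N ud yd).
Local Notation YF := (data_YF Tini N yd).
Local Notation Hd := (data_Hd Tini N ud yd).
Local Notation Pi1 := (data_Pi1 Tini N ud yd).
Local Notation constraints := (trajectory_constraints uini yini Gamma U Y).

(** Tested against the candidate [(col_mx H1 (YF *m Pi1), YF *m H1^+)], where
    [H1^+] is the Moore-Penrose inverse, the residual of a minimizer exceeds
    that of the candidate by two squares, which therefore vanish. *)
Lemma inner_minimizerE Hstar K :
  minimizer (inner_problem Tini N ud yd) (Hstar, K) ->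
  Hstar = col_mx H1 (YF *m Pi1).
Proof.
move=> [/= KE /(_ (col_mx H1 (YF *m Pi1), YF *m mp_inverse H1))/=].
rewrite col_mxKd mulmxA => /(_ erefl); rewrite -mulmxA.
rewrite -{1}(vsubmxK Hstar) KE /data_Hd opp_col_mx 2!add_col_mx.
rewrite 2!sqr_frobnorm_col_mx subrr frobnorm0 least_squares_pythagoras.
set x := frobnorm (usubmx Hstar - _); set y := frobnorm (_ - YF *m Pi1).
move=> le_xy; have /eqP : x ^+ 2 + y ^+ 2 = 0.
  by apply/eqP; rewrite eq_le addr_ge0 ?sqr_ge0 // andbT; move: le_xy; lra.
rewrite paddr_eq0 ?sqr_ge0 // !sqrf_eq0 => /andP[/eqP x0 /eqP y0].
rewrite -(vsubmxK Hstar) KE.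
by rewrite (subr0_eq (frobnorm_eq0 x0)) (subr0_eq (frobnorm_eq0 y0)).
Qed.

(** Projecting [g] moves the factor [Pi1] from the matrix to the vector. *)
Lemma trajectory_constraints_project g s u y :
  constraints (col_mx H1 (YF *m Pi1)) (g, s, u, y) ->
  constraints Hd (Pi1 *m g, s, u, y).
Proof.
move=> [Gs Uu Yy]; rewrite mul_col_mx => /eq_col_mx[gH1 gYF].
split=> //; rewrite /data_Hd mul_col_mx; congr col_mx; last by rewrite mulmxA.
by rewrite mulmxA mulmx_mp_inverseK.
Qed.

Lemma regularizer_project g : l2norm ((1%:M - Pi1) *m (Pi1 *m g)) = 0.
Proof.
rewrite mulmxA mulmxBl mul1mx {2}/data_Pi1 /data_Pi1 -mulmxA mulmx_mp_inverseK.
by rewrite subrr mul0mx /l2norm frobnorm0.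
Qed.

Lemma convex_trajectory_constraints
    (H : 'M[R]_((Tini * m + (Tini * p + N * m)) + N * p, T - (Tini + N) + 1)) :
  @convex_set R 'cV[R]_(Tini * p) Gamma ->
  @convex_set R 'cV[R]_m U -> @convex_set R 'cV[R]_p Y ->
  @convex_set R _ (constraints H).
Proof.
move=> cG cU cY [[[g s] u] y] [[[g' s'] u'] y'] t.
move=> /set_mem[Gs Uu Yy E] /set_mem[Gs' Uu' Yy' E'].
apply: mem_set; split => [|k|k|].
- exact: convex_set_comb.
- by rewrite block_linear; exact: convex_set_comb.
- by rewrite block_linear; exact: convex_set_comb.
(* The affine parts [uini] and [yini] are the same at both ends. *)
have tK (V : lmodType R) (v : V) : t%:num *: v + (1 - t%:num) *: v = v.
  by rewrite -scalerDl addrC subrK scale1r.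
change (H *m (t%:num *: g + (1 - t%:num) *: g') =
  col_mx (col_mx uini (col_mx (yini + (t%:num *: s + (1 - t%:num) *: s'))
    (t%:num *: u + (1 - t%:num) *: u'))) (t%:num *: y + (1 - t%:num) *: y')).
rewrite linearD !linearZ /= E E' !scale_col_mx !add_col_mx tK.
by congr (col_mx (col_mx _ (col_mx _ _)) _); rewrite !scalerDr addrACA tK.
Qed.

Lemma single_level_cost_convex (lambda_g : R) :
  posdef Q -> posdef Rw -> 0 <= lambda_y -> 0 <= lambda_g ->
  @convex_function R _ setT
    (cost (single_level_problem N ud yd uini yini Gamma U Y Q Rw lambda_y
      lambda_g)).
Proof.
move=> Qpos Rpos ly0 lg0 t [[[g s] u] y] [[[g' s'] u'] y'] _ _.
have t01 : 0 <= t%:num <= 1 by rewrite ge0 le1.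
have hu := wsqnorm_convex u u' Rpos t01.
have hy := wsqnorm_convex y y' Qpos t01.
have hs := ler_wpM2l ly0 (sqr_frobnorm_convex s s' t01).
have hg := ler_wpM2l lg0
  (frobnorm_convex ((1%:M - Pi1) *m g) ((1%:M - Pi1) *m g') t01).
rewrite !scalemxAr -mulmxDr in hg.
apply: (le_trans (lerD (lerD (lerD hu hy) hs) hg)).
rewrite convRE /= /l2norm /unstable.onem le_eqVlt (_ : (_ == _) = true) //.
apply/eqP; ring.
Qed.

End Relaxation.

Theorem theorem2 (R : realType) (m p Tini N T : nat)
    (hm : (0 < m)%N) (hp : (0 < p)%N) (hTini : (0 < Tini)%N) (hN : (0 < N)%N)
    (hT : (Tini + N < T)%N)
    (ud : 'cV[R]_(T * m)) (yd : 'cV[R]_(T * p))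
    (uini : 'cV[R]_(Tini * m)) (yini : 'cV[R]_(Tini * p))
    (Gamma : set 'cV[R]_(Tini * p)) (U : set 'cV[R]_m) (Y : set 'cV[R]_p)
    (Q : 'M[R]_p) (Rw : 'M[R]_m) (lambda_y : R)
    (hQ : posdef Q) (hRw : posdef Rw) (hlambda_y : 0 < lambda_y)
    (hGamma : @convex_set R 'cV[R]_(Tini * p) Gamma)
    (hU : @convex_set R 'cV[R]_m U) (hY : @convex_set R 'cV[R]_p Y)
    (lambda_g : R) (hlambda_g : 0 <= lambda_g) :
  let B := bilevel_problem N ud yd uini yini Gamma U Y Q Rw lambda_y in
  let L := single_level_problem N ud yd uini yini Gamma U Y Q Rw lambda_y lambda_g in
  [/\ convex_problem L,
      forall s u y, feasible_triple B s u y -> feasible_triple L s u y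
    & (optimal_value L <= optimal_value B)%E].
Proof.
move=> B L.
have BL g s u y : feasible B (g, s, u, y) ->
    feasible L (data_Pi1 Tini N ud yd *m g, s, u, y).
  by move=> [H [K [/inner_minimizerE -> /trajectory_constraints_project]]].
split.
- split; first exact: convex_trajectory_constraints.
  by apply: single_level_cost_convex => //; exact: ltW.
- by move=> s u y [g /BL Lg]; exists (data_Pi1 Tini N ud yd *m g).
- apply: ereal_inf_le_tmp => _ [[[[g s] u] y] /BL Lg <-].
  exists (data_Pi1 Tini N ud yd *m g, s, u, y) => //=.
  by rewrite regularizer_project mulr0 addr0 [X in X + _]addrC.
Qed.
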